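(* Let $0<p<1$ and let $(C_n)$ be a sequence of real numbers with $C_n\to\infty$ and $C_n/\log n\to 0$ as $n\to\infty$. For positive integers $m,n$ let $X_m$ and $Y_n$ be two independent random graphs with laws $G(m,p)$ and $G(n,\tfrac12)$, respectively. Then: (I) if $m(n)=\left\lfloor 2\log_2 n+1-\frac{C_n}{\log n}\right\rfloor$, then $\lim_{n\to\infty}\mathbb P\big(X_{m(n)}\text{ is embeddable in }Y_n\big)=1$; (II) if $m(n)=\left\lceil 2\log_2 n+1+\frac{C_n}{\log n}\right\rceil$, then $\lim_{n\to\infty}\mathbb P\big(X_{m(n)}\text{ is embeddable in }Y_n\big)=0$.
   Context: $G(n,p)$ is the law of the Erdős–Rényi random undirected simple graph on a set of $n$ vertices in which each of the $\binom n2$ potential edges is present with probability $p$, independently. A graph $\Gamma$ is embeddable in a graph $\Gamma'$ if $\Gamma$ is isomorphic to some induced subgraph of $\Gamma'$. $\log$ is the natural logarithm. *)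

(* Defs.v *)
From HB Require Import structures.
From mathcomp Require Import all_boot all_order all_algebra.
From mathcomp Require Import all_classical all_reals all_analysis.

Set Implicit Arguments.
Unset Strict Implicit.
Unset Printing Implicit Defensive.
Import Order.TTheory GRing.Theory Num.Theory.

Local Open Scope classical_set_scope.
Local Open Scope ring_scope.

(* Adjacency is stored as a finite function so that Leibniz equality of graphs
   is extensional, and graphs on V form a finType. *)
Definition sgraph_axiom (V : finType) (e : {ffun V * V -> bool}) : bool :=
  [forall x, ~~ e (x, x)] && [forall x, forall y, e (x, y) == e (y, x)].

Record sgraph (V : finType) := SGraph {
  sgraph_val :> {ffun V * V -> bool} ;
  sgraphP : sgraph_axiom sgraph_val
}.

HB.instance Definition _ (V : finType) := [isSub for @sgraph_val V].
HB.instance Definition _ (V : finType) := [Finite of sgraph V by <:].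

Definition adj (V : finType) (G : sgraph V) : rel V := fun x y => G (x, y).

Lemma empty_sgraph_subproof (V : finType) :
  sgraph_axiom [ffun _ : V * V => false].
Proof.
apply/andP; split; first by apply/forallP => x; rewrite ffunE.
by apply/forallP => x; apply/forallP => y; rewrite !ffunE.
Qed.

Definition empty_sgraph (V : finType) : sgraph V :=
  SGraph (empty_sgraph_subproof V).

HB.instance Definition _ (V : finType) :=
  isPointed.Build (sgraph V) (empty_sgraph V).

HB.instance Definition _ (V : finType) :=
  @isMeasurable.Build default_measure_display (sgraph V)
    discrete_measurable discrete_measurable0
    discrete_measurableC discrete_measurableU.

Lemma induced_subproof (V : finType) (G : sgraph V) (S : {set V}) :
  sgraph_axiom
    [ffun xy : {x : V | x \in S} * {x : V | x \in S} =>
       adj G (val xy.1) (val xy.2)].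
Proof.
have /andP[/forallP irr /forallP sym] := sgraphP G.
apply/andP; split; first by apply/forallP => x; rewrite ffunE; exact: irr.
apply/forallP => x; apply/forallP => y; rewrite !ffunE.
by have /forallP := sym (val x); exact.
Qed.

Definition induced (V : finType) (G : sgraph V) (S : {set V}) :
  sgraph {x : V | x \in S} := SGraph (induced_subproof G S).

Definition isomorphic (V W : finType) (G : sgraph V) (H : sgraph W) : Prop :=
  exists2 f : V -> W, bijective f & forall x y, adj H (f x) (f y) = adj G x y.

Definition embeddable (V W : finType) (G : sgraph V) (H : sgraph W) : Prop :=
  exists S : {set W}, isomorphic G (induced H S).

(* Independent Bernoulli(p) edge indicators; the pairs i < j enumerate each
   potential edge exactly once. *)
Definition Gnp_pmf (R : realType) (n : nat) (p : R) (G : sgraph 'I_n) : R :=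
  \prod_(e : 'I_n * 'I_n | (e.1 < e.2)%N) bernoulli_pmf p (adj G e.1 e.2).

Definition has_law_Gnp (R : realType) (d : measure_display)
    (T : measurableType d) (P : probability T R) (n : nat)
    (X : {RV P >-> sgraph 'I_n}) (p : R) : Prop :=
  forall G : sgraph 'I_n, distribution P X [set G] = (Gnp_pmf p G)%:E.

Definition independent_RV (R : realType) (d d1 d2 : measure_display)
    (T : measurableType d) (T1 : measurableType d1) (T2 : measurableType d2)
    (P : probability T R) (X : {RV P >-> T1}) (Y : {RV P >-> T2}) : Prop :=
  forall (A : set T1) (B : set T2), measurable A -> measurable B ->
    P (X @^-1` A `&` Y @^-1` B) = (P (X @^-1` A) * P (Y @^-1` B))%E.

Definition log2 (R : realType) (x : R) : R := ln x / ln 2.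

(* Main.v *)
(* Given X, the number N of injections [m] -> [n] that realize X as an induced subgraph of Y
   has mean mu = n(n-1)...(n-m+1) 2^-C(m,2), whatever the value of X.  With
   eps = sqrt(2)^(m-1) / n one has mu <= eps^-m, and in case (II) this tends to 0, so the
   first moment method applies.  In case (I), eps^m -> 0 and the second moment is used, over
   the joint law of X and Y.  Two injections f, g whose images share k points both realize X
   with probability at most 2^(-2 C(m,2) + C(k,2)) times the probability that the partial
   map f^-1 g on k points is a partial automorphism of X.  When k > m/2 the latter is at most
   r^(k j) for some r < 1, where j is the number of points moved by f^-1 g, because 0 < p < 1
   makes X asymmetric.  Without this factor the m! pairs of injections with equal images
   would already ruin the estimate.  Summing over g gives
   E N^2 / mu^2 <= (1 + o(1)) (1 + o(1) + 2 eps^m). *)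
Require Import Defs.
From mathcomp Require Import all_boot all_order all_algebra.
From mathcomp Require Import all_classical all_reals all_analysis.
From mathcomp Require Import ring lra zify.
Set Implicit Arguments.
Unset Strict Implicit.
Unset Printing Implicit Defensive.
Import Order.TTheory GRing.Theory Num.Theory.
Import numFieldNormedType.Exports.
Local Open Scope ring_scope.

(** * Edges as independent coordinates of a random graph *)

Lemma prod_indicator (R : realType) (I : finType) (b : pred I) :
  \prod_i (b i)%:R = [forall i, b i]%:R :> R.
Proof.
have [/forallP bT|/forallPn[i /negbTE bi]] := boolP [forall i, b i].
  by rewrite big1 // => i _; rewrite bT.
by rewrite (bigD1 i) //= bi mul0r.
Qed.

Section Edges.
Variable n : nat.

Definition edge := {e : 'I_n * 'I_n | (e.1 < e.2)%N}.

Lemma adjC (V : finType) (G : sgraph V) x y : adj G x y = adj G y x.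
Proof.
have /andP[_ /forallP sym] := sgraphP G.
by have /forallP/(_ y)/eqP := sym x.
Qed.

Lemma adjxx (V : finType) (G : sgraph V) x : adj G x x = false.
Proof.
have /andP[/forallP irr _] := sgraphP G.
exact: negbTE (irr x).
Qed.

Definition adj_edge (G : sgraph 'I_n) (e : edge) : bool :=
  adj G (val e).1 (val e).2.

Definition ffun_of_edges (phi : {ffun edge -> bool}) : {ffun 'I_n * 'I_n -> bool} :=
  [ffun xy => [exists e : edge, phi e && ((val e == xy) || (val e == (xy.2, xy.1)))]].

Lemma ffun_of_edges_axiom phi : sgraph_axiom (ffun_of_edges phi).
Proof.
apply/andP; split; apply/forallP => x.
  rewrite ffunE; apply/existsP => -[[[a b] /= ab]].
  by rewrite !xpair_eqE orbb => /andP[_ /andP[/eqP ax /eqP bx]]; rewrite ax bx ltnn in ab.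
apply/forallP => y; rewrite !ffunE; apply/eqP/eq_existsb => e.
by rewrite orbC.
Qed.

Definition graph_of_edges phi := SGraph (ffun_of_edges_axiom phi).

Lemma adj_graph_of_edges phi e : adj_edge (graph_of_edges phi) e = phi e.
Proof.
rewrite /adj_edge /adj /= ffunE; apply/existsP/idP => [[e' /andP[he']]|he]; last first.
  by exists e; rewrite he -surjective_pairing eqxx.
rewrite -surjective_pairing (inj_eq val_inj) => /orP[/eqP <- //|/eqP ee'].
by have := valP e'; rewrite ee' /= ltnNge ltnW// (valP e).
Qed.

Lemma adj_edge_inj (G H : sgraph 'I_n) : adj_edge G =1 adj_edge H -> G = H.
Proof.
move=> GH; apply: val_inj; apply/ffunP => -[x y].
rewrite -!/(adj _ x y); have [xy|yx|xy] := ltngtP x y.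
- exact: GH (exist _ (x, y) xy).
- by rewrite adjC [RHS]adjC; exact: GH (exist _ (y, x) yx).
- have -> : x = y by exact: val_inj.
  by rewrite !adjxx.
Qed.

Lemma graph_of_edges_bij : bijective graph_of_edges.
Proof.
exists (fun G => [ffun e => adj_edge G e]) => [phi|G].
  by apply/ffunP => e; rewrite ffunE adj_graph_of_edges.
by apply: adj_edge_inj => e; rewrite adj_graph_of_edges ffunE.
Qed.

Definition unordered_subproof (x y : 'I_n) (xy : x != y) :
  ((if (x < y)%N then (x, y) else (y, x)).1 < (if (x < y)%N then (x, y) else (y, x)).2)%N.
Proof.
case: (ltngtP x y) => //= /ord_inj xy'.
by rewrite xy' eqxx in xy.
Qed.

Definition unordered (x y : 'I_n) (xy : x != y) : edge :=
  exist (fun e : 'I_n * 'I_n => (e.1 < e.2)%N) _ (unordered_subproof xy).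

Lemma adj_unordered G x y (xy : x != y) : adj_edge G (unordered xy) = adj G x y.
Proof. by rewrite /adj_edge /=; case: ifP => //= _; rewrite adjC. Qed.

Lemma unordered_eq x y (xy : x != y) x' y' (xy' : x' != y') :
  unordered xy = unordered xy' -> (x = x' /\ y = y') \/ (x = y' /\ y = x').
Proof.
move=> /(congr1 val) /=; case: ifP => _; case: ifP => _ [-> ->]; by [left|right].
Qed.

Variables (R : realType) (p : R).

Lemma Gnp_pmfE (G : sgraph 'I_n) :
  Gnp_pmf p G = \prod_(e : edge) bernoulli_pmf p (adj_edge G e).
Proof.
exact: (big_sub (fun e : 'I_n * 'I_n => (e.1 < e.2)%N)
  (fun e => bernoulli_pmf p (adj G e.1 e.2))).
Qed.

(** A graph amounts to a free choice of one Boolean per edge, so the sum of products distributes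
    into a product of two-term sums. *)
Lemma sum_Gnp_prod (F : edge -> bool -> R) :
  \sum_(G : sgraph 'I_n) \prod_(e : edge) F e (adj_edge G e) =
  \prod_(e : edge) (F e true + F e false).
Proof.
rewrite (reindex graph_of_edges) /=; last exact/onW_bij/graph_of_edges_bij.
under [RHS]eq_bigr => e _ do rewrite -(big_bool _ (F e)).
rewrite bigA_distr_bigA; apply: eq_bigr => phi _.
by apply: eq_bigr => e _; rewrite adj_graph_of_edges.
Qed.

(** Each constraint is moved into the factor of its own edge. By injectivity a constrained edge
    keeps exactly one of its two terms, and every other edge contributes [p + (1 - p) = 1]. *)
Lemma Gnp_marginal (I : finType) (gam : I -> edge) (c : I -> bool) :
  injective gam ->
  \sum_(G : sgraph 'I_n) Gnp_pmf p G * [forall i, adj_edge G (gam i) == c i]%:R =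
  \prod_i bernoulli_pmf p (c i).
Proof.
move=> gam_inj.
pose ok e b := [forall i, (gam i == e) ==> (b == c i)].
transitivity (\sum_(G : sgraph 'I_n)
    \prod_e (bernoulli_pmf p (adj_edge G e) * (ok e (adj_edge G e))%:R)).
  apply: eq_bigr => G _; rewrite big_split -Gnp_pmfE prod_indicator.
  congr (_ * _%:R); congr nat_of_bool; apply/forallP/forallP => [ok_G e|ok_G i].
    by apply/forallP => i; apply/implyP => /eqP <-; exact: ok_G.
  by move/forallP: (ok_G (gam i)) => /(_ i); rewrite eqxx.
rewrite (sum_Gnp_prod (fun e b => bernoulli_pmf p b * (ok e b)%:R)).
rewrite (bigID (mem [set gam i | i : I])) /= [X in _ * X]big1 ?mulr1.
  rewrite big_imset /=; last by move=> i j _ _; exact: gam_inj.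
  apply: eq_bigr => i _.
  have okE b : ok (gam i) b = (b == c i).
    apply/forallP/eqP => [/(_ i)|-> j]; first by rewrite eqxx => /eqP.
    by apply/implyP => /eqP /gam_inj ->.
  by rewrite !okE; case: (c i); rewrite /= ?mulr1 ?mulr0 ?addr0 ?add0r.
move=> e /imsetP e_gam.
have okE b : ok e b.
  by apply/forallP => i; apply/implyP => /eqP ie; case: e_gam; exists i.
by rewrite !okE !mulr1 /= addrC subrK.
Qed.
End Edges.

(** * Probability that a partial map is a partial automorphism of a random graph *)

Section PairedEdges.
Variables (R : realType) (p : R).

(** Summing over the common values [c] of the pairs turns agreement into prescribed values on
    distinct edges, and each pair then contributes [p * p] or [(1 - p) * (1 - p)]. *)
Lemma Gnp_paired n (I : finType) (alpha beta : I -> edge n) :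
  injective alpha -> injective beta -> (forall i j, alpha i != beta j) ->
  \sum_(G : sgraph 'I_n) Gnp_pmf p G *
     [forall i, adj_edge G (alpha i) == adj_edge G (beta i)]%:R =
  (p ^+ 2 + (1 - p) ^+ 2) ^+ #|I|.
Proof.
move=> alpha_inj beta_inj disj.
pose gam (z : I + I) := match z with inl i => alpha i | inr i => beta i end.
have gam_inj : injective gam.
  move=> [i|i] [j|j] /= /eqP; rewrite 1?eq_sym.
  - by move/eqP/alpha_inj ->.
  - by rewrite eq_sym (negbTE (disj _ _)).
  - by rewrite (negbTE (disj _ _)).
  - by move/eqP/beta_inj ->.
pose c2 (c : {ffun I -> bool}) (z : I + I) := match z with inl i => c i | inr i => c i end.
transitivity (\sum_(G : sgraph 'I_n) \sum_(c : {ffun I -> bool})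
    Gnp_pmf p G * [forall z, adj_edge G (gam z) == c2 c z]%:R).
  apply: eq_bigr => G _; rewrite -mulr_sumr; congr (_ * _).
  pose c0 := [ffun i => adj_edge G (alpha i)].
  (* For a given graph only the observed values [c0] contribute. *)
  rewrite (bigD1 c0) //= big1 ?addr0 => [|c cc0].
    congr (_%:R); congr nat_of_bool; apply/forallP/forallP => [H [i|i]|H i] /=.
    - by rewrite ffunE.
    - by rewrite ffunE eq_sym.
    - by move: (H (inr i)); rewrite /= ffunE eq_sym.
  case: forallP => // H; case/eqP: cc0; apply/ffunP => i.
  by rewrite ffunE; move: (H (inl i)) => /eqP.
rewrite exchange_big /=.
under eq_bigr => c _.
  rewrite Gnp_marginal // big_sumType /= -big_split /=.
  over.
rewrite -(bigA_distr_bigA (fun=> fun b => bernoulli_pmf p b * bernoulli_pmf p b)) /=.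
by under eq_bigr => i _ do rewrite big_bool; rewrite prodr_const /= !expr2.
Qed.

Lemma Gnp_pmf_ge0 n (G : sgraph 'I_n) : 0 <= p <= 1 -> 0 <= Gnp_pmf p G.
Proof. by move=> p01; apply: prodr_ge0 => e _; exact: bernoulli_pmf_ge0. Qed.

Definition partial_iso m (K : {set 'I_m}) (h : 'I_m -> 'I_m) (G : sgraph 'I_m) :=
  [forall x in K, forall y in K, adj G (h x) (h y) == adj G x y].

(* The edges between [J] and [K] minus [J] and its image are disjoint from their images, so
   their preservation amounts to independent constraints. *)
Lemma Gnp_partial_iso_le m (K J : {set 'I_m}) (h : 'I_m -> 'I_m) :
  0 <= p <= 1 -> {in K &, injective h} -> J \subset K ->
  {in J, forall x, h x \notin J} ->
  \sum_(G : sgraph 'I_m) Gnp_pmf p G * (partial_iso K h G)%:R <=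
  (p ^+ 2 + (1 - p) ^+ 2) ^+ (#|J| * #|K :\: (J :|: h @: J)|).
Proof.
move=> p01 h_inj JK hJ; set W := K :\: _.
pose I := {z : 'I_m * 'I_m | z \in finset.setX J W}.
have IP (z : I) : [/\ (val z).1 \in J, (val z).2 \in K, (val z).2 \notin J,
    (val z).2 \notin h @: J & (val z).1 \in K].
  have := valP z; rewrite inE => /andP[zJ]; rewrite !inE negb_or => /andP[/andP[? ?] ?].
  by split=> //; exact: (fintype.subsetP JK).
have neq (z : I) : (val z).1 != (val z).2.
  by have [zJ _ + _ _] := IP z; apply: contraNneq => <-.
have hneq (z : I) : h (val z).1 != h (val z).2.
  by have [_ zK _ _ zK'] := IP z; apply: contra (neq z) => /eqP/h_inj ->.
pose alpha z := unordered (neq z); pose beta z := unordered (hneq z).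
have <- : #|{: I}| = (#|J| * #|W|)%N by rewrite card_sig -cardsX; apply: eq_card.
rewrite -(@Gnp_paired m _ beta alpha); last first.
(* An image edge has an endpoint in [h @: J], which meets neither [J] nor [W], while an edge counted
   by [I] has its endpoints in [J] and [W]. *)
- move=> i j; apply/eqP => /unordered_eq.
  have [iJ iK iNJ ih iK'] := IP i; have [jJ jK jNJ jh jK'] := IP j.
  move=> [[ij _]|[ij ji]].
    by move: (hJ _ iJ); rewrite ij jJ.
  by move: jh; rewrite -ij imset_f.
- move=> i j /unordered_eq.
  have [iJ iK iNJ ih iK'] := IP i; have [jJ jK jNJ jh jK'] := IP j.
  move=> [[ij ji]|[ij ji]]; first by apply: val_inj; apply: injective_projections.
  by move: jNJ; rewrite -ij iJ.
- move=> i j /unordered_eq.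
  have [iJ iK iNJ ih iK'] := IP i; have [jJ jK jNJ jh jK'] := IP j.
  move=> [[/h_inj ij /h_inj ji]|[/h_inj ij ji]].
    by apply: val_inj; apply: injective_projections; [exact: ij|exact: ji].
  by move: jNJ; rewrite -ij // iJ.
apply: ler_sum => G _; apply: ler_wpM2l; first exact: Gnp_pmf_ge0.
rewrite ler_nat; case: (boolP (partial_iso _ _ _)) => // /forall_inP iso.
rewrite lt0b; apply/forallP => i; rewrite !adj_unordered.
by have [iJ iK iNJ ih iK'] := IP i; have /forall_inP := iso _ iK'; apply.
Qed.

(* A maximal [J] satisfies [set x in K | h x != x] \subset J :|: h @: J :|: h @^-1: J, unless it is
   stopped by the bound on its size. *)
Lemma displaced_subset m (K : {set 'I_m}) (h : 'I_m -> 'I_m) :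
  {in K &, injective h} ->
  exists J : {set 'I_m}, [/\ J \subset K, {in J, forall x, h x \notin J},
    (4 * #|J| <= #|K|)%N &
    (#|K| < 4 * #|J|.+1)%N || (#|[set x in K | h x != x]| <= 3 * #|J|)%N].
Proof.
move=> h_inj.
pose P (J : {set 'I_m}) := [&& J \subset K, [forall x in J, h x \notin J] &
  (4 * #|J| <= #|K|)%N].
have P0 : P finset.set0.
  rewrite /P finset.sub0set cards0 muln0 leq0n !andbT /=.
  by apply/forall_inP => x; rewrite inE.
have [J /maxsetP[/and3P[JK /forall_inP hJ J4] Jmax] _] := maxset_exists P0.
exists J; split => //.
case: ltnP => //= K4.
have D_sub : [set x in K | h x != x] \subset J :|: h @: J :|: [set x in K | h x \in J].
  apply/fintype.subsetP => x; rewrite !inE => /andP[xK hx].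
  apply: contraT; rewrite !negb_or xK /= => /andP[/andP[xJ xhJ] hxJ].
  (* A displaced point outside the three sets could be added to [J], since [K4] leaves room for one
     more element; this contradicts maximality. *)
  have PxJ : P (x |: J).
    apply/and3P; split.
    - by rewrite finset.subUset finset.sub1set xK.
    - apply/forall_inP => y; rewrite !inE negb_or => /orP[/eqP ->|yJ].
        by rewrite hx.
      by rewrite hJ // andbT; apply: contraNneq xhJ => <-; rewrite imset_f.
    - by rewrite cardsU1 xJ add1n.
  by move: xJ; rewrite -(Jmax _ PxJ) ?finset.subsetUr // finset.setU11.
apply: leq_trans (subset_leq_card D_sub) _.
apply: leq_trans (leq_card_setU _ _) _.
have hJ_le : (#|[set x in K | h x \in J]| <= #|J|)%N.
  rewrite -(card_in_imset (f := h)); last first.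
    by move=> x y; rewrite !inE => /andP[xK _] /andP[yK _]; exact: h_inj.
  by apply: subset_leq_card; apply/fintype.subsetP => _ /imsetP[x + ->]; rewrite inE => /andP[].
apply: leq_trans (leq_add (leq_card_setU _ _) hJ_le) _.
by rewrite mulSn mulSn mul1n addnA leq_add2r leq_add2l leq_imset_card.
Qed.

(** With [W] the points of [K] outside [J] and its image, and [D] the displaced points,
    [#|K| <= 2 * #|W|] and [#|D| <= 7 * #|J|]. The exponent [14 = 2 * 7] pays for both constants. *)
Lemma Gnp_partial_iso_displaced m (K : {set 'I_m}) (h : 'I_m -> 'I_m) (r : R) :
  0 <= p <= 1 -> 0 <= r <= 1 -> p ^+ 2 + (1 - p) ^+ 2 <= r ^+ 14 ->
  {in K &, injective h} -> (4 <= #|K|)%N ->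
  \sum_(G : sgraph 'I_m) Gnp_pmf p G * (partial_iso K h G)%:R <=
  (r ^+ #|K|) ^+ #|[set x in K | h x != x]|.
Proof.
move=> p01 /andP[r0 r1] qr h_inj K4.
have [J [JK hJ J4 Jmax]] := displaced_subset h_inj.
apply: le_trans (Gnp_partial_iso_le p01 h_inj JK hJ) _.
set q := (p ^+ 2 + _) in qr *; set W := K :\: _; set D := [set x in K | _] in Jmax *.
have q0 : 0 <= q by rewrite addr_ge0 // sqr_ge0.
have DK : (#|D| <= #|K|)%N.
  by apply: subset_leq_card; apply/fintype.subsetP => x; rewrite inE => /andP[].
have WK : (#|K| - 2 * #|J| <= #|W|)%N.
  rewrite /W cardsD; apply: leq_sub2l.
  apply: leq_trans (subset_leq_card (finset.subsetIr _ _)) _.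
  apply: leq_trans (leq_card_setU _ _) _.
  by rewrite mul2n -addnn leq_add2l leq_imset_card.
have expo : (#|K| * #|D| <= 14 * (#|J| * #|W|))%N.
  (* If [J] was stopped by its size bound, [4 <= #|K|] forces [J] to be nonempty, whence
     [#|D| <= #|K| <= 4 * #|J| + 3 <= 7 * #|J|]. *)
  have D7 : (#|D| <= 7 * #|J|)%N by case/orP: Jmax; lia.
  have W2 : (#|K| <= 2 * #|W|)%N by lia.
  apply: leq_trans (leq_mul W2 D7) _; nia.
apply: le_trans (lerXn2r _ _ _ qr) _; rewrite ?nnegrE ?exprn_ge0 //.
by rewrite -!exprM; apply: ler_wiXn2l.
Qed.
End PairedEdges.

(** * Injections, and pairs of injections, realizing one graph inside another *)

Definition edges_in n (S : {set 'I_n}) : {set edge n} :=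
  [set e : edge n | ((val e).1 \in S) && ((val e).2 \in S)].

Lemma in_edges_in n (S : {set 'I_n}) e :
  (e \in edges_in S) = ((val e).1 \in S) && ((val e).2 \in S).
Proof. by rewrite inE. Qed.

(** Sending an edge to its set of endpoints is a bijection onto the two-element subsets of [S]. *)
Lemma card_edges_in n (S : {set 'I_n}) : #|edges_in S| = 'C(#|S|, 2).
Proof.
rewrite -cards_draws.
pose ends (e : edge n) : {set 'I_n} := [set (val e).1; (val e).2].
have ends_inj : injective ends.
  move=> e e' /setP ee'; apply: val_inj.
  have := ee' (val e').2; have := ee' (val e').1.
  have := ee' (val e).2; have := ee' (val e).1.
  rewrite !inE !eqxx ?orbT.
  have := valP e; have := valP e'.
  case: (val e) => a b; case: (val e') => a' b' /=.
  rewrite -!val_eqE /= => ab' ab.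
  move=> /esym/orP[]/eqP h1 /esym/orP[]/eqP h2 /orP[]/eqP h3 /orP[]/eqP h4;
    by (congr (_, _); apply: val_inj => /=; lia) || lia.
rewrite -(card_imset _ ends_inj); apply: eq_card => A; apply/imsetP/idP.
  move=> [e]; rewrite in_edges_in => /andP[e1 e2] ->.
  rewrite inE finset.subUset !finset.sub1set e1 e2 cards2.
  by rewrite -val_eqE /= (ltn_eqF (valP e)).
rewrite inE => /andP[AS /cards2P[x [y [xy AE]]]].
have [xA yA] : x \in A /\ y \in A by rewrite AE !inE !eqxx orbT.
exists (unordered xy).
  by rewrite in_edges_in /=; case: ifP => _ /=; rewrite !(fintype.subsetP AS).
by rewrite AE /ends /=; case: ifP => //= _; rewrite finset.setUC.
Qed.

Lemma card_edge n : #|{: edge n}| = 'C(n, 2).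
Proof.
rewrite -[in RHS](card_ord n) -[in RHS]cardsT -card_edges_in; apply: eq_card => e.
by rewrite in_edges_in !inE.
Qed.

Section Embeddings.
Variables (R : realType) (m n : nat).

Definition emb (f : {ffun 'I_m -> 'I_n}) (G : sgraph 'I_m) (H : sgraph 'I_n) : bool :=
  [forall x, forall y, adj H (f x) (f y) == adj G x y].

Lemma embP (f : {ffun 'I_m -> 'I_n}) (G : sgraph 'I_m) (H : sgraph 'I_n) :
  reflect (forall x y, adj H (f x) (f y) = adj G x y) (emb f G H).
Proof.
apply: (iffP forallP) => [fe x y|fe x]; first by have /forallP/(_ y)/eqP := fe x.
by apply/forallP => y; apply/eqP.
Qed.

Lemma bernoulli_half b : bernoulli_pmf (1 / 2 : R) b = 1 / 2.
Proof. by case: b => //=; field. Qed.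

(** An injection carries the [C(m, 2)] edges of [G] to distinct edges of [H], each of which must
    take one prescribed value. *)
Lemma sum_emb (f : {ffun 'I_m -> 'I_n}) (G : sgraph 'I_m) : injective f ->
  \sum_(H : sgraph 'I_n) Gnp_pmf (1 / 2 : R) H * (emb f G H)%:R = (1 / 2) ^+ 'C(m, 2).
Proof.
move=> f_inj.
have neq (e : edge m) : f (val e).1 != f (val e).2.
  by rewrite (inj_eq f_inj) -val_eqE /= (ltn_eqF (valP e)).
pose gam e := unordered (neq e).
have gam_inj : injective gam.
  move=> e e' /unordered_eq [[/f_inj h1 /f_inj h2]|[/f_inj h1 /f_inj h2]].
    by apply: val_inj; apply: injective_projections.
  by have := valP e; rewrite h1 h2 ltnNge (ltnW (valP e')).
transitivity (\sum_(H : sgraph 'I_n) Gnp_pmf (1 / 2 : R) H *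
    [forall e, adj_edge H (gam e) == adj_edge G e]%:R).
  apply: eq_bigr => H _; congr (_ * _%:R); congr nat_of_bool.
  apply/embP/forallP => [fe e|fe x y]; first by rewrite adj_unordered fe.
  have [xy|yx|/ord_inj ->] := ltngtP x y; last by rewrite !adjxx.
    by have /eqP := fe (exist _ (x, y) xy); rewrite adj_unordered.
  by rewrite adjC [RHS]adjC; have /eqP := fe (exist _ (y, x) yx); rewrite adj_unordered.
rewrite Gnp_marginal //.
by under eq_bigr => e _ do rewrite bernoulli_half; rewrite prodr_const card_edge.
Qed.

(** The domain of the partial map [f^-1 \o g]; for injective [g] its size is the number of points
    shared by the two images. *)
Definition cross (f g : {ffun 'I_m -> 'I_n}) : {set 'I_m} :=
  [set y | g y \in f @: [set: 'I_m]%SET].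

(** For injective [f], the points that the partial map [f^-1 \o g] displaces. *)
Definition moved (f g : {ffun 'I_m -> 'I_n}) : {set 'I_m} :=
  [set y in cross f g | g y != f y].

Lemma in_moved (f g : {ffun 'I_m -> 'I_n}) y :
  (y \in moved f g) = (y \in cross f g) && (g y != f y).
Proof. by rewrite inE. Qed.

(* The partial map [f^-1 \o g], with junk value [y] outside of [cross f g]. *)
Definition transfer (f g : {ffun 'I_m -> 'I_n}) (y : 'I_m) : 'I_m :=
  odflt y [pick x | f x == g y].

Lemma transferK (f g : {ffun 'I_m -> 'I_n}) : {in cross f g, forall y, f (transfer f g y) = g y}.
Proof.
move=> y; rewrite inE /transfer => /imsetP[x _ gy]; case: pickP => [z /eqP //|/(_ x)].
by rewrite gy eqxx.
Qed.

(** If some [H0] realizes [G] along both maps, then [f^-1 \o g] preserves adjacency in [G], and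
    every other such [H] agrees with [H0] on the edges inside either image. There are
    [2 * C(m, 2) - C(k, 2)] of these when [k] points are shared. *)
Lemma sum_emb2 (f g : {ffun 'I_m -> 'I_n}) (G : sgraph 'I_m) : injective f -> injective g ->
  \sum_(H : sgraph 'I_n) Gnp_pmf (1 / 2 : R) H * (emb f G H && emb g G H)%:R <=
  (1 / 2) ^+ (2 * 'C(m, 2)) * 2 ^+ 'C(#|cross f g|, 2) *
    (partial_iso (cross f g) (transfer f g) G)%:R.
Proof.
move=> f_inj g_inj.
have [[H0 /andP[/embP f0 /embP g0]]|none] :=
    pselect (exists H0, emb f G H0 && emb g G H0); last first.
  rewrite big1 ?mulr_ge0 ?exprn_ge0 ?divr_ge0 // => H _.
  by case: andP => [[? ?]|_]; rewrite ?mulr0 //; case: none; exists H; apply/andP.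
have -> : partial_iso (cross f g) (transfer f g) G.
  apply/forall_inP => x xK; apply/forall_inP => y yK.
  by rewrite -f0 !transferK // g0.
rewrite mulr1.
pose Sf := f @: [set: 'I_m]%SET; pose Sg := g @: [set: 'I_m]%SET.
pose U := edges_in Sf :|: edges_in Sg.
pose I := {e : edge n | e \in U}.
have -> : (1 / 2) ^+ (2 * 'C(m, 2)) * 2 ^+ 'C(#|cross f g|, 2) = (1 / 2) ^+ #|U| :> R.
  have USUM : (#|U| + 'C(#|cross f g|, 2) = 2 * 'C(m, 2))%N.
    have <- : #|edges_in Sf :&: edges_in Sg| = 'C(#|cross f g|, 2).
      have <- : #|Sf :&: Sg| = #|cross f g|.
        rewrite -(card_imset _ g_inj); apply: eq_card => v.
        rewrite inE; apply/andP/imsetP => [[vf /imsetP[y _ vy]]|[y]].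
          by exists y; rewrite // inE -vy.
        by rewrite inE => yK ->; rewrite yK imset_f.
      rewrite -card_edges_in; apply: eq_card => e.
      by rewrite inE !in_edges_in !inE andbACA.
    by rewrite cardsUI !card_edges_in !card_imset // cardsT card_ord mul2n addnn.
  by rewrite -USUM exprD -mulrA -exprMn mul1r mulVf ?pnatr_eq0 // expr1n mulr1.
have <- : #|{: I}| = #|U| by rewrite card_sig; apply: eq_card.
rewrite -prodr_const.
(* Each factor [1 / 2] is read as the probability of the value taken by [H0], so that the power
   becomes the probability of agreeing with [H0] on [U]. *)
under eq_bigr => i _ do rewrite -(bernoulli_half (adj_edge H0 (val i))).
rewrite -(Gnp_marginal _ (gam := fun i : I => val i)); last by move=> i j /val_inj.
apply: ler_sum => H _; apply: ler_wpM2l; first by apply: Gnp_pmf_ge0; lra.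
rewrite ler_nat; case: andP => [[/embP fH /embP gH]|//].
rewrite lt0b; apply/forallP => -[e eU] /=.
rewrite /adj_edge; move: eU; rewrite inE !in_edges_in.
move=> /orP[] /andP[/imsetP[x _ ->] /imsetP[y _ ->]].
  by rewrite fH f0.
by rewrite gH g0.
Qed.

(* For overlaps of at most [m./2] points the asymmetry of [X] is not exploited. *)
Definition decay (r : R) (k : nat) : R := if (k <= m./2)%N then 1 else r ^+ k.

(** The sum over [H] at fixed [G] leaves the indicator that [f^-1 \o g] is a partial automorphism of
    [G], which is then averaged over [G]. The condition [8 <= m] makes an overlap above [m./2] large
    enough for [Gnp_partial_iso_displaced]. *)
Lemma pair_moment_le (p r : R) (f g : {ffun 'I_m -> 'I_n}) : 0 <= p <= 1 -> 0 <= r <= 1 ->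
  p ^+ 2 + (1 - p) ^+ 2 <= r ^+ 14 -> (8 <= m)%N -> injective f -> injective g ->
  \sum_(G : sgraph 'I_m) \sum_(H : sgraph 'I_n)
    Gnp_pmf p G * Gnp_pmf (1 / 2) H * (emb f G H && emb g G H)%:R <=
  (1 / 2) ^+ (2 * 'C(m, 2)) *
    (2 ^+ 'C(#|cross f g|, 2) * decay r #|cross f g| ^+ #|moved f g|).
Proof.
move=> p01 r01 qr m8 f_inj g_inj.
set K := cross f g; set A := (1 / 2) ^+ _; set B := 2 ^+ _.
have A0 : 0 <= A by rewrite exprn_ge0 // divr_ge0.
have B0 : 0 <= B by rewrite exprn_ge0.
have h_inj : {in K &, injective (transfer f g)}.
  by move=> x y xK yK /(congr1 f); rewrite !transferK // => /g_inj.
apply: (@le_trans _ _ (\sum_(G : sgraph 'I_m)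
    A * B * (Gnp_pmf p G * (partial_iso K (transfer f g) G)%:R))).
  apply: ler_sum => G _.
  under eq_bigr => H _ do rewrite -mulrA.
  rewrite -mulr_sumr mulrCA; apply: ler_wpM2l; first exact: Gnp_pmf_ge0.
  exact: sum_emb2.
rewrite -mulr_sumr mulrA; apply: ler_wpM2l; first exact: mulr_ge0.
rewrite /decay; case: leqP => [_|mK].
  rewrite expr1n.
  (* The empty [J] gives the trivial bound by 1. *)
  have := @Gnp_partial_iso_le R p m K finset.set0 _ p01 h_inj.
  rewrite cards0 mul0n expr0; apply; first exact: finset.sub0set.
  by move=> x; rewrite inE.
suff -> : moved f g = [set x in K | transfer f g x != x].
  by apply: Gnp_partial_iso_displaced => //; lia.
apply/setP => y; rewrite in_moved [RHS]finset.in_set; apply: andb_id2l => yK.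
by rewrite -(inj_eq f_inj) transferK.
Qed.

(** The maps [g] are sorted by [K = cross f g], then by [k = #|K|]. A vertex [y] in [K] goes to
    [f y] with weight 1 or to one of at most [m] other points with weight [rho k]; a vertex outside
    [K] has at most [n] choices. *)
Lemma sum_cross_moved (rho : nat -> R) (f : {ffun 'I_m -> 'I_n}) : (forall k, 0 <= rho k) ->
  \sum_(g : {ffun 'I_m -> 'I_n})
     2 ^+ 'C(#|cross f g|, 2) * rho #|cross f g| ^+ #|moved f g| <=
  \sum_(k < m.+1) 'C(m, k)%:R * (2 ^+ 'C(k, 2) *
     ((1 + m%:R * rho k) ^+ k * n%:R ^+ (m - k))).
Proof.
move=> rho0.
rewrite (partition_big (cross f) xpredT) //=.
rewrite (partition_big (fun K : {set 'I_m} => inord #|K| : 'I_m.+1) xpredT) //=.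
apply: ler_sum => k _.
have -> : 'C(m, k)%:R = \sum_(K : {set 'I_m} | inord #|K| == k) 1 :> R.
  rewrite sumr_const; congr (_%:R).
  have := cards_draws [set: 'I_m]%SET k; rewrite cardsT card_ord => <-.
  rewrite cardsE; apply: eq_card => K.
  rewrite [LHS]unfold_in finset.subsetT [RHS]unfold_in /= -eqnE inordK //.
  by rewrite ltnS -[X in (_ <= X)%N](card_ord m) max_card.
rewrite mulr_suml; apply: ler_sum => K /eqP Kk.
have {Kk}Kk : #|K| = k.
  by rewrite -Kk inordK // ltnS -[X in (_ <= X)%N](card_ord m) max_card.
rewrite mul1r.
(* For a given value [K] of [cross f g] the summand factors over the vertices [y]. *)
pose th y v : R := if y \in K
  then (v \in f @: [set: 'I_m]%SET)%:R * (if v == f y then 1 else rho k)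
  else (v \notin f @: [set: 'I_m]%SET)%:R.
have th0 y v : 0 <= th y v.
  by rewrite /th; case: ifP => _ //; apply: mulr_ge0 => //; case: ifP.
apply: (@le_trans _ _ (\sum_(g : {ffun 'I_m -> 'I_n}) 2 ^+ 'C(k, 2) * \prod_y th y (g y))).
  rewrite big_mkcond /=; apply: ler_sum => g _; case: eqP => [gK|_]; last first.
    by rewrite mulr_ge0 ?exprn_ge0 // prodr_ge0.
  rewrite gK Kk; apply: ler_wpM2l; first by rewrite exprn_ge0.
  rewrite (bigID (mem (moved f g))) /= -[X in X <= _]mulr1.
  have thE y : th y (g y) = if y \in moved f g then rho k else 1.
    rewrite /th in_moved gK; case: ifP; rewrite -gK inE => ->; rewrite ?mul1r //=.
    by case: eqP.
  rewrite (eq_bigr (fun=> rho k)) => [|y yM]; last by rewrite thE yM.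
  rewrite prodr_const big1 // => y /negbTE yM; by rewrite thE yM.
rewrite -mulr_sumr; apply: ler_wpM2l; first by rewrite exprn_ge0.
rewrite -(bigA_distr_bigA th) /=.
apply: (@le_trans _ _ (\prod_(y : 'I_m) if y \in K then 1 + m%:R * rho k else n%:R)).
  apply: ler_prod => y _; rewrite sumr_ge0 //=.
  rewrite /th; case: ifP => _; last first.
    apply: (@le_trans _ _ (\sum_(v : 'I_n) 1)); last by rewrite sumr_const card_ord.
    by apply: ler_sum => v _; rewrite lern1 leq_b1.
  rewrite (bigD1 (f y)) //= eqxx mulr1 imset_f // lerD2l.
  apply: (@le_trans _ _ (\sum_(v in f @: [set: 'I_m]%SET) rho k)).
    rewrite big_mkcond [X in _ <= X]big_mkcond; apply: ler_sum => v _ /=.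
    by case: eqP => _ /=; case: ifP => _; rewrite ?mul1r ?mul0r.
  rewrite sumr_const mulr_natl; apply: ler_wpMn2l => //.
  by rewrite (leq_trans (leq_imset_card _ _)) // cardsT card_ord.
rewrite (bigID (mem K)) /= (eq_bigr (fun=> 1 + m%:R * rho k)) => [|y ->//].
rewrite [X in _ * X](eq_bigr (fun=> n%:R)) => [|y /negbTE ->//].
have mk : (m - k)%N = #|[predC K]|.
  have := cardC (mem K); rewrite card_ord Kk => mE.
  apply/eqP; rewrite -(eqn_add2l k) subnKC //; last by rewrite -ltnS ltn_ord.
  by rewrite mE.
by rewrite !prodr_const Kk mk.
Qed.
End Embeddings.

(** * First and second moments of the number of realizations *)

Section Moments.
Variables (R : realType) (p : R) (m n : nat).
Hypothesis p01 : 0 <= p <= 1.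

Lemma Gnp_total k (q : R) : \sum_(G : sgraph 'I_k) Gnp_pmf q G = 1.
Proof.
(* The empty family of constraints. *)
have := @Gnp_marginal k R q void (of_void _) (of_void _).
rewrite [RHS]big_pred0 => [<-|[]//]; last by case.
apply: eq_bigr => G _; case: forallP => [_|[]]; last by case.
by rewrite mulr1.
Qed.

Definition weight (G : sgraph 'I_m) (H : sgraph 'I_n) : R :=
  Gnp_pmf p G * Gnp_pmf (1 / 2) H.

Definition embedb (G : sgraph 'I_m) (H : sgraph 'I_n) : bool :=
  [exists f : {ffun 'I_m -> 'I_n}, injectiveb f && emb f G H].

Definition num_emb (G : sgraph 'I_m) (H : sgraph 'I_n) : R :=
  \sum_(f : {ffun 'I_m -> 'I_n} | injectiveb f) (emb f G H)%:R.

(** The probability of embedding for independent graphs of the two laws, as a finite sum;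
    [embeddable_probability] makes the link. *)
Definition embed_prob : R :=
  \sum_(G : sgraph 'I_m) \sum_(H : sgraph 'I_n) weight G H * (embedb G H)%:R.

Definition mean_emb : R := (n ^_ m)%:R * (1 / 2) ^+ 'C(m, 2).

(** For a fixed first injection, a bound on the weighted count of second ones, sorted by the number
    [k] of shared points. Divided by [n ^_ m] it bounds the ratio of the second moment to the
    squared mean. *)
Definition overlap_sum (r : R) : R :=
  \sum_(k < m.+1) 'C(m, k)%:R * (2 ^+ 'C(k, 2) *
     ((1 + m%:R * decay m r k) ^+ k * n%:R ^+ (m - k))).

Lemma weight_ge0 G H : 0 <= weight G H.
Proof. by apply: mulr_ge0; apply: Gnp_pmf_ge0 => //; lra. Qed.

Lemma num_emb_ge0 G H : 0 <= num_emb G H.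
Proof. exact: sumr_ge0. Qed.

Lemma embedb_le_num G H : (embedb G H)%:R <= num_emb G H.
Proof.
case: (boolP (embedb G H)) => [/existsP[f /andP[fi fe]]|_]; last exact: num_emb_ge0.
by rewrite /num_emb (bigD1 f) //= fe lerDl sumr_ge0.
Qed.

Lemma num_emb_eq0 G H : ~~ embedb G H -> num_emb G H = 0.
Proof.
move=> /existsPn GH; rewrite /num_emb big1 // => f fi.
by move: (GH f); rewrite fi /= => /negbTE ->.
Qed.

Lemma card_injective : #|[pred f : {ffun 'I_m -> 'I_n} | injectiveb f]| = (n ^_ m)%N.
Proof. by have := card_inj_ffuns 'I_m 'I_n; rewrite !card_ord cardsE. Qed.

Lemma mean_num_emb :
  \sum_(G : sgraph 'I_m) \sum_(H : sgraph 'I_n) weight G H * num_emb G H = mean_emb.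
Proof.
transitivity (\sum_(f : {ffun 'I_m -> 'I_n} | injectiveb f) \sum_(G : sgraph 'I_m)
   Gnp_pmf p G * \sum_(H : sgraph 'I_n) Gnp_pmf (1 / 2) H * (emb f G H)%:R).
  rewrite [RHS]exchange_big; apply: eq_bigr => G _ /=.
  under [RHS]eq_bigr => f _ do rewrite mulr_sumr.
  rewrite [RHS]exchange_big; apply: eq_bigr => H _ /=.
  by rewrite mulr_sumr; apply: eq_bigr => f _; rewrite mulrA.
rewrite (eq_bigr (fun=> (1 / 2) ^+ 'C(m, 2))) => [|f /injectiveP fi].
  by rewrite sumr_const card_injective /mean_emb mulr_natl.
under eq_bigr => G _ do rewrite sum_emb //.
by rewrite -mulr_suml Gnp_total mul1r.
Qed.

(** Markov's inequality for [num_emb]. *)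
Lemma embed_prob_le : embed_prob <= mean_emb.
Proof.
rewrite -mean_num_emb; apply: ler_sum => G _; apply: ler_sum => H _.
by apply: ler_wpM2l; [exact: weight_ge0|exact: embedb_le_num].
Qed.

Lemma embed_prob_le1 : embed_prob <= 1.
Proof.
apply: (@le_trans _ _ (\sum_(G : sgraph 'I_m) \sum_(H : sgraph 'I_n) weight G H)).
  apply: ler_sum => G _; apply: ler_sum => H _.
  by apply: ler_piMr; [exact: weight_ge0|rewrite lern1 leq_b1].
under eq_bigr => G _ do rewrite -mulr_sumr Gnp_total mulr1.
by rewrite Gnp_total.
Qed.

Lemma embed_prob_ge0 : 0 <= embed_prob.
Proof.
by apply: sumr_ge0 => G _; apply: sumr_ge0 => H _; rewrite mulr_ge0 // weight_ge0.
Qed.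

Variable r : R.
Hypotheses (r01 : 0 <= r <= 1) (qr : p ^+ 2 + (1 - p) ^+ 2 <= r ^+ 14) (m8 : (8 <= m)%N).

(** The square expands into a sum over pairs of injections, each controlled by [pair_moment_le]. *)
Lemma second_moment_le :
  \sum_(G : sgraph 'I_m) \sum_(H : sgraph 'I_n) weight G H * num_emb G H ^+ 2 <=
  (n ^_ m)%:R * ((1 / 2) ^+ (2 * 'C(m, 2)) * overlap_sum r).
Proof.
have decay_ge0 k : 0 <= decay m r k.
  by rewrite /decay; case: ifP => // _; apply: exprn_ge0; case/andP: r01.
pose W (f g : {ffun 'I_m -> 'I_n}) :=
  2 ^+ 'C(#|cross f g|, 2) * decay m r #|cross f g| ^+ #|moved f g|.
have W0 f g : 0 <= W f g by rewrite mulr_ge0 ?exprn_ge0.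
apply: (@le_trans _ _ (\sum_(f : {ffun 'I_m -> 'I_n} | injectiveb f)
    \sum_(g : {ffun 'I_m -> 'I_n} | injectiveb g) (1 / 2) ^+ (2 * 'C(m, 2)) * W f g)).
  apply: (@le_trans _ _ (\sum_(f : {ffun 'I_m -> 'I_n} | injectiveb f)
    \sum_(g : {ffun 'I_m -> 'I_n} | injectiveb g)
    \sum_(G : sgraph 'I_m) \sum_(H : sgraph 'I_n)
       weight G H * (emb f G H && emb g G H)%:R)); last first.
    apply: ler_sum => f /injectiveP fi; apply: ler_sum => g /injectiveP gi.
    exact: pair_moment_le.
  rewrite le_eqVlt; apply/orP; left; apply/eqP/esym.
  under eq_bigr => f _ do rewrite exchange_big.
  rewrite exchange_big; apply: eq_bigr => G _ /=.
  under eq_bigr => f _ do rewrite exchange_big.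
  rewrite exchange_big; apply: eq_bigr => H _ /=.
  rewrite /num_emb expr2 big_distrlr /= mulr_sumr; apply: eq_bigr => f _.
  by rewrite mulr_sumr; apply: eq_bigr => g _; rewrite -mulnb natrM.
(* For each [f] the sum over injective [g] is enlarged to all maps, where [sum_cross_moved] gives a
   bound independent of [f]. *)
rewrite -card_injective mulr_natl -sumr_const; apply: ler_sum => f _.
rewrite -mulr_sumr; apply: ler_wpM2l; first by rewrite exprn_ge0 // divr_ge0.
apply: le_trans (sum_cross_moved f decay_ge0).
by rewrite big_mkcond; apply: ler_sum => g _; case: ifP => // _; exact: W0.
Qed.

(** Second moment method: the embedding probability is at least [2 - E N^2 / mu^2]. The condition
    [m <= n] makes [mu] positive. *)
Lemma embed_prob_ge : (m <= n)%N ->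
  2 - overlap_sum r / (n ^_ m)%:R <= embed_prob.
Proof.
move=> mn.
have N0 : 0 < (n ^_ m)%:R :> R by rewrite ltr0n ffact_gt0.
set A : R := (1 / 2) ^+ 'C(m, 2).
have A0 : 0 < A by rewrite exprn_gt0 // divr_gt0.
have mu0 : 0 < mean_emb by rewrite mulr_gt0.
(* Chebyshev: [1{N > 0} >= 1 - (N / mu - 1)^2], both sides being [0] when [N = 0]. *)
apply: (@le_trans _ _ (\sum_(G : sgraph 'I_m) \sum_(H : sgraph 'I_n)
   weight G H * (2 / mean_emb * num_emb G H - num_emb G H ^+ 2 / mean_emb ^+ 2))); last first.
  apply: ler_sum => G _; apply: ler_sum => H _.
  apply: ler_wpM2l; first exact: weight_ge0.
  case: (boolP (embedb G H)) => [_|/num_emb_eq0 ->]; last by rewrite expr0n !mul0r mulr0 subr0.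
  have -> : 2 / mean_emb * num_emb G H - num_emb G H ^+ 2 / mean_emb ^+ 2 =
    1 - (num_emb G H / mean_emb - 1) ^+ 2 by field; rewrite gt_eqF.
  by rewrite gerBl sqr_ge0.
have -> : \sum_(G : sgraph 'I_m) \sum_(H : sgraph 'I_n)
   weight G H * (2 / mean_emb * num_emb G H - num_emb G H ^+ 2 / mean_emb ^+ 2) =
   2 / mean_emb * (\sum_(G : sgraph 'I_m) \sum_(H : sgraph 'I_n) weight G H * num_emb G H) -
   (\sum_(G : sgraph 'I_m) \sum_(H : sgraph 'I_n) weight G H * num_emb G H ^+ 2)
      / mean_emb ^+ 2.
  rewrite mulr_sumr mulr_suml -sumrB; apply: eq_bigr => G _.
  rewrite mulr_sumr mulr_suml -sumrB; apply: eq_bigr => H _.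
  by field; rewrite gt_eqF.
rewrite mean_num_emb divfK ?gt_eqF // lerD2l lerN2 ler_pdivrMr ?exprn_gt0 //.
apply: le_trans second_moment_le _.
rewrite le_eqVlt; apply/orP; left; apply/eqP.
rewrite /mean_emb -/A mulnC exprM -/A.
by field; rewrite gt_eqF.
Qed.
End Moments.

(** * Estimate of the overlap sum *)

Lemma ffact_le_expn m k : (m ^_ k <= m ^ k)%N.
Proof.
elim: k m => [|k IH] [|m]; rewrite ?ffact0n // ffactnS expnS /=.
rewrite leq_mul2l (leq_trans (IH _)) //.
by case: k {IH} => // k; rewrite leq_exp2r.
Qed.

Lemma bin_le_expn m k : ('C(m, k) <= m ^ k)%N.
Proof.
apply: leq_trans _ (ffact_le_expn m k).
by rewrite -bin_ffact leq_pmulr ?fact_gt0.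
Qed.

Section Overlap.
Variable R : realType.

(** In the induction step the cross term [2 * k * w * w] is at most [w] by the smallness hypothesis;
    the factor 2 makes room for it. *)
Lemma exprD1_le (w : R) k : 0 <= w -> 2 * (k%:R * w) <= 1 ->
  (1 + w) ^+ k <= 1 + 2 * (k%:R * w).
Proof.
move=> w0; elim: k => [|k IH]; first by rewrite expr0 mul0r mulr0 addr0.
rewrite exprSr -natr1 mulrDl mul1r => kw1.
have kw : 2 * (k%:R * w) <= 1 by lra.
have kw0 : 0 <= k%:R * w by exact: mulr_ge0.
apply: le_trans (ler_wpM2r _ (IH kw)) _; first lra.
nra.
Qed.

(** Each new factor is [n * (1 - k / n)] with [k <= m], so it costs at most [m / n] in the relative
    error. *)
Lemma ffact_ge (n m k : nat) : (0 < n)%N -> (k <= m)%N -> (m <= n)%N ->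
  n%:R ^+ k * (1 - k%:R * m%:R / n%:R) <= (n ^_ k)%:R :> R.
Proof.
move=> n0 + mn; elim: k => [|k IH] km; first by rewrite !mul0r subr0 mulr1 ffactn0.
have n0R : 0 < n%:R :> R by rewrite ltr0n.
have kn : (k <= n)%N by lia.
rewrite ffactnSr natrM natrB //.
apply: le_trans _ (ler_wpM2r _ (IH (ltnW km))); last by rewrite subr_ge0 ler_nat.
rewrite exprSr -[X in X <= _]mulrA -[X in _ <= X]mulrA; apply: ler_wpM2l; first exact: exprn_ge0.
have -> : n%:R - k%:R = n%:R * (1 - k%:R / n%:R) :> R by field; rewrite gt_eqF.
rewrite mulrCA; apply: ler_wpM2l; first exact: ltW.
have kmR : k%:R <= m%:R :> R by rewrite ler_nat ltnW.
have k0 : 0 <= k%:R / n%:R :> R by rewrite divr_ge0.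
have m0 : 0 <= k%:R * m%:R / n%:R :> R by rewrite divr_ge0 ?mulr_ge0.
have kmn : k%:R / n%:R <= m%:R / n%:R :> R by rewrite ler_pM2r ?invr_gt0.
rewrite -natr1 mulrDl mul1r mulrDl.
nra.
Qed.

(** The square root [s] of 2 makes [2 ^ C(k, 2)] an exact [k]-th power, to be matched with the other
    [k]-th powers in an overlap term. *)
Lemma expr2_bin (s : R) k : s ^+ 2 = 2 -> 2 ^+ 'C(k, 2) = (s ^+ k.-1) ^+ k.
Proof.
move=> <-; rewrite -!exprM; congr (_ ^+ _); rewrite bin2 mul2n [RHS]mulnC.
rewrite -[RHS]odd_double_half (_ : odd _ = false) ?add0n //.
by rewrite oddM; case: k => //= k; case: (odd k).
Qed.

Variables (m n : nat) (r s : R).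
Hypotheses (r01 : 0 <= r <= 1) (s1 : 1 <= s) (s2 : s ^+ 2 = 2).
Hypotheses (m8 : (8 <= m)%N) (n0 : (0 < n)%N).

Let h := m./2.
(** The error term: up to a constant it bounds the total of the overlaps with [0 < k < m], and it
    bounds the relative loss from [n ^ m] to [n ^_ m]. *)
Let a : R := m%:R ^+ 3 * s^-1 ^+ h.
Let eps : R := s ^+ m.-1 / n%:R.
(** The second bound keeps [(1 + m * r ^ k) ^ k] at most 2 for every overlap [k] above [h]. *)
Hypotheses (a_small : 2 * a <= 1) (b_small : 2 * (m%:R ^+ 3 * r ^+ h) <= 1).
Hypothesis eps1 : eps <= 1.

Let s0 : 0 < s. Proof. exact: lt_le_trans ltr01 s1. Qed.
Let si0 : 0 <= s^-1. Proof. by rewrite invr_ge0 ltW. Qed.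
Let si1 : s^-1 <= 1. Proof. by rewrite invf_le1. Qed.
Let n0R : 0 < n%:R :> R. Proof. by rewrite ltr0n. Qed.
Let m1R : 1 <= m%:R :> R. Proof. by rewrite ler1n; exact: leq_trans m8. Qed.
Let eps0 : 0 <= eps. Proof. by rewrite divr_ge0 // exprn_ge0 // ltW. Qed.

Let a0 : 0 <= a. Proof. by rewrite mulr_ge0 ?exprn_ge0. Qed.
Let a1 : a < 1.
Proof. by move: a0 a_small; generalize a => c; lra. Qed.

Let x : R := m%:R * (1 + m%:R) * s^-1 ^+ h.

Lemma overlap_x : [/\ 0 <= x, x <= 1 & m%:R * x <= 2 * a].
Proof.
have t0 : 0 <= s^-1 ^+ h by exact: exprn_ge0.
have x0 : 0 <= x by rewrite /x !mulr_ge0 // addr_ge0.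
have mx : m%:R * x <= 2 * a.
  rewrite /x /a !mulrA; apply: ler_wpM2r => //.
  have : 0 <= m%:R * m%:R * (m%:R - 1) :> R by rewrite !mulr_ge0 // subr_ge0.
  lra.
split=> //; apply: le_trans _ (le_trans mx a_small).
exact: ler_peMl.
Qed.

(** Relative to [n ^ m] the term is [C(m, k) * (1 + m * decay) ^ k * d ^ k] with
    [d = s ^ (k - 1) / n]. For [k <= h] it is at most [x ^ k]. For [h < k < m] the middle factor is
    at most 2 and the rest is at most [x ^ (m - k)]. For [k = m] one has [d = eps]. *)
Lemma overlap_term_le k : (k <= m)%N -> (0 < k)%N ->
  'C(m, k)%:R * (2 ^+ 'C(k, 2) * ((1 + m%:R * decay m r k) ^+ k * n%:R ^+ (m - k)))
  <= n%:R ^+ m * (2 * x + (k == m)%:R * (2 * eps ^+ m)).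
Proof.
move=> km k0.
have [x0 x1 _] := overlap_x.
have t0 : 0 <= s^-1 ^+ h by exact: exprn_ge0.
have /andP[r0 r1] := r01.
(* In this form [eps <= 1] gives at once [d <= s^-1 ^ (m - k)]. *)
pose d := eps * s^-1 ^+ (m - k).
have d0 : 0 <= d by rewrite mulr_ge0 // exprn_ge0.
have sE : s ^+ k.-1 = n%:R * d.
  rewrite /d /eps; have -> : m.-1 = (k.-1 + (m - k))%N by clear -k0 km; lia.
  rewrite exprD exprVn; field.
  by rewrite ?expf_neq0 ?gt_eqF //.
rewrite (expr2_bin _ s2) sE exprMn.
have -> : 'C(m, k)%:R * (n%:R ^+ k * d ^+ k *
    ((1 + m%:R * decay m r k) ^+ k * n%:R ^+ (m - k))) =
  n%:R ^+ m * ('C(m, k)%:R * (1 + m%:R * decay m r k) ^+ k * d ^+ k).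
  by rewrite -[in n%:R ^+ m](subnKC km) exprD; ring.
apply: ler_wpM2l; first exact: exprn_ge0.
have de : d <= s^-1 ^+ (m - k) by rewrite /d ler_piMl // exprn_ge0.
have [kh|hk] := leqP k h.
  have dk : decay m r k = 1 by rewrite /decay kh.
  apply: (@le_trans _ _ x); last first.
    have : 0 <= (k == m)%:R * (2 * eps ^+ m) by rewrite !mulr_ge0 // exprn_ge0.
    by lra.
  rewrite dk mulr1; apply: (@le_trans _ _ (x ^+ k)); last first.
    by rewrite -[X in _ <= X]expr1; apply: ler_wiXn2l.
  have -> : x ^+ k = m%:R ^+ k * (1 + m%:R) ^+ k * (s^-1 ^+ h) ^+ k.
    by rewrite /x !exprMn.
  apply: ler_pM.
  - by rewrite mulr_ge0 ?exprn_ge0 // addr_ge0.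
  - exact: exprn_ge0.
  - apply: ler_wpM2r; first by rewrite exprn_ge0 // addr_ge0.
    by rewrite -natrX ler_nat bin_le_expn.
  - apply: lerXn2r; rewrite ?nnegrE //; apply: le_trans de _.
    apply: ler_wiXn2l => //; rewrite /h in kh *; clear -kh; lia.
have dk : (1 + m%:R * decay m r k) ^+ k <= 2.
  have -> : decay m r k = r ^+ k by rewrite /decay leqNgt hk.
  have rk : r ^+ k <= r ^+ h by apply: ler_wiXn2l => //; exact: ltnW.
  have rh0 : 0 <= r ^+ h by exact: exprn_ge0.
  have w0 : 0 <= m%:R * r ^+ k by rewrite mulr_ge0 // exprn_ge0.
  have w1 : m%:R * r ^+ k <= m%:R * r ^+ h by apply: ler_wpM2l.
  have kmR : k%:R <= m%:R :> R by rewrite ler_nat.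
  have kw : 2 * (k%:R * (m%:R * r ^+ k)) <= 1.
    apply: le_trans _ b_small; apply: ler_wpM2l => //.
    apply: (@le_trans _ _ (m%:R * (m%:R * r ^+ h))); first by apply: ler_pM.
    by rewrite mulrA; apply: ler_wpM2r => //; rewrite -expr2; apply: ler_weXn2l.
  by apply: le_trans (exprD1_le w0 kw) _; lra.
have dd0 : 0 <= (1 + m%:R * decay m r k) ^+ k.
  by rewrite exprn_ge0 // addr_ge0 // mulr_ge0 // /decay; case: ifP => // _; exact: exprn_ge0.
have [kmE|kmN] := eqVneq k m.
  rewrite mul1r kmE binn mul1r in dk dd0 *.
  have -> : d = eps by rewrite /d kmE subnn expr0 mulr1.
  have : (1 + m%:R * decay m r m) ^+ m * eps ^+ m <= 2 * eps ^+ m.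
    by apply: ler_wpM2r => //; exact: exprn_ge0.
  lra.
rewrite mul0r addr0 -mulrA mulrCA; apply: ler_pM => //.
  by rewrite mulr_ge0 // exprn_ge0.
(* For large [k] the roles are exchanged: [C(m, m - k) <= m ^ (m - k)], and [(s^-1 ^ (m - k)) ^ k]
   is regarded as an [(m - k)]-th power. *)
rewrite -(bin_sub km).
apply: (@le_trans _ _ (x ^+ (m - k))); last first.
  by rewrite -[X in _ <= X]expr1; apply: ler_wiXn2l; rewrite // subn_gt0 ltn_neqAle kmN.
have -> : x ^+ (m - k) = (m%:R * (1 + m%:R)) ^+ (m - k) * (s^-1 ^+ h) ^+ (m - k).
  by rewrite /x exprMn.
apply: ler_pM => //; first exact: exprn_ge0.
  apply: (@le_trans _ _ (m%:R ^+ (m - k))).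
    by rewrite -natrX ler_nat bin_le_expn.
  by apply: lerXn2r; rewrite ?nnegrE ?mulr_ge0 ?addr_ge0 // ler_peMr // lerDl.
apply: (@le_trans _ _ ((s^-1 ^+ (m - k)) ^+ k)).
  by apply: lerXn2r; rewrite ?nnegrE // exprn_ge0.
rewrite -!exprM; apply: ler_wiXn2l => //.
by rewrite mulnC leq_mul2l (ltnW hk) orbT.
Qed.

(** The term [k = 0] is exactly [n ^ m]; the bounds [2 * x] of the [m] others add up to at most
    [4 * a], and [k = m] adds [2 * eps ^ m]. *)
Lemma overlap_sum_le : overlap_sum m n r <= n%:R ^+ m * (1 + 4 * a + 2 * eps ^+ m).
Proof.
have [x0 x1 mx] := overlap_x.
rewrite /overlap_sum big_ord_recl /= bin0 bin_small // !expr0 !mul1r subn0.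
apply: (@le_trans _ _ (n%:R ^+ m + \sum_(i < m)
   n%:R ^+ m * (2 * x + (lift ord0 i == m :> nat)%:R * (2 * eps ^+ m)))).
  by rewrite lerD2l; apply: ler_sum => i _; apply: overlap_term_le.
rewrite -mulr_sumr big_split /= sumr_const card_ord -mulr_suml -mulr_natl.
have -> : \sum_(i < m) (lift ord0 i == m :> nat)%:R = 1 :> R.
  (* The overlap [k = m] has index [m.-1], because [lift ord0] shifts by one. *)
  have m0 : (m.-1 < m)%N by clear -m8; lia.
  rewrite (bigD1 (Ordinal m0)) //= /bump /= add1n prednK ?eqxx; last exact: leq_trans m8.
  rewrite big1 ?addr0 // => i; rewrite -val_eqE /= => im.
  by rewrite (_ : (_ == _) = false) //; apply/eqP => im'; move/eqP: im; apply; clear -im'; lia.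
rewrite mul1r -[X in X + _]mulr1 -mulrDr; apply: ler_wpM2l; first exact: exprn_ge0.
lra.
Qed.

(** [eps <= 1] means [s ^ (m - 1) <= n], and [h <= m - 1]. *)
Lemma sqr_m_le : m%:R ^+ 2 / n%:R <= a.
Proof.
apply: (@le_trans _ _ (m%:R ^+ 2 * s^-1 ^+ m.-1)).
  apply: ler_wpM2l; first exact: exprn_ge0.
  rewrite exprVn lef_pV2 ?posrE ?exprn_gt0 //.
  by have := eps1; rewrite ler_pdivrMr // mul1r.
rewrite /a; apply: ler_pM; rewrite ?exprn_ge0 //.
  by apply: ler_weXn2l.
by apply: ler_wiXn2l => //; rewrite /h; clear -m8; lia.
Qed.

Lemma m_le_n : (m <= n)%N.
Proof.
rewrite -(ler_nat R).
have := sqr_m_le; rewrite ler_pdivrMr // => mn2.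
apply: (@le_trans _ _ (m%:R ^+ 2)); first by rewrite expr2 ler_peMr.
by apply: le_trans mn2 _; rewrite ler_piMl // ltW.
Qed.

Lemma overlap_ratio_le :
  overlap_sum m n r / (n ^_ m)%:R <= (1 + 4 * a + 2 * eps ^+ m) / (1 - a).
Proof.
have a1' : 0 < 1 - a by rewrite subr_gt0.
have N0 : 0 < n%:R ^+ m :> R by exact: exprn_gt0.
have e0 : 0 <= eps ^+ m by exact: exprn_ge0.
have F : n%:R ^+ m * (1 - a) <= (n ^_ m)%:R.
  apply: le_trans _ (ffact_ge n0 (leqnn m) m_le_n).
  by rewrite ler_pM2l // lerD2l lerN2 -expr2 sqr_m_le.
have F0 : 0 < n%:R ^+ m * (1 - a) by exact: mulr_gt0.
apply: (@le_trans _ _ (n%:R ^+ m * (1 + 4 * a + 2 * eps ^+ m) / (n%:R ^+ m * (1 - a)))).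
  apply: (@le_trans _ _ (n%:R ^+ m * (1 + 4 * a + 2 * eps ^+ m) / (n ^_ m)%:R)).
    by apply: ler_wpM2r; [rewrite invr_ge0|exact: overlap_sum_le].
  apply: ler_wpM2l; first by rewrite mulr_ge0 ?exprn_ge0 // !addr_ge0 // mulr_ge0.
  by rewrite lef_pV2 ?posrE //; exact: lt_le_trans F0 F.
by rewrite invfM mulrACA divff ?mul1r // gt_eqF.
Qed.
End Overlap.

(** * The embedding event and its probability *)

Section EmbeddingEvent.
Local Open Scope classical_set_scope.

(** An isomorphism onto an induced subgraph composes with the inclusion; conversely the image of an
    injection serves as [S]. *)
Lemma embeddableP m n (G : sgraph 'I_m) (H : sgraph 'I_n) :
  embeddable G H <-> embedb G H.
Proof.
split=> [[S [f f_bij fadj]]|/existsP[f /andP[/injectiveP f_inj /embP fadj]]].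
  apply/existsP; exists [ffun x => val (f x)]; apply/andP; split.
    by apply/injectiveP => x y; rewrite !ffunE => /val_inj /(bij_inj f_bij).
  by apply/embP => x y; rewrite !ffunE -fadj /adj /= ffunE.
exists (f @: [set: 'I_m]%SET).
have fS x : f x \in f @: [set: 'I_m]%SET by rewrite imset_f.
exists (fun x => exist (fun v => v \in f @: [set: 'I_m]%SET) (f x) (fS x)).
  apply: inj_card_bij => [x y /(congr1 val) /f_inj //|].
  rewrite card_sig -[X in (_ <= X)%N]cardsT -(card_imset _ f_inj).
  by apply: subset_leq_card; apply/fintype.subsetP.
by move=> x y; rewrite /adj /= ffunE /= fadj.
Qed.

(** The event is the finite disjoint union, over the embeddable pairs of graphs, of the events that
    [X] and [Y] take these values; independence factors each of them. *)
Lemma embeddable_probability (R : realType) (d : measure_display)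
    (T : measurableType d) (P : probability T R) m n
    (X : {RV P >-> sgraph 'I_m}) (Y : {RV P >-> sgraph 'I_n}) (p : R) :
  has_law_Gnp X p -> has_law_Gnp Y (1 / 2) -> independent_RV X Y ->
  P [set w | embeddable (X w) (Y w)] = (embed_prob p m n)%:E.
Proof.
move=> lawX lawY indXY.
have lX G : P (X @^-1` [set G]) = (Gnp_pmf p G)%:E by exact: lawX.
have lY H : P (Y @^-1` [set H]) = (Gnp_pmf (1 / 2) H)%:E by exact: lawY.
pose F (z : sgraph 'I_m * sgraph 'I_n) := X @^-1` [set z.1] `&` Y @^-1` [set z.2].
pose s := enum [pred z : sgraph 'I_m * sgraph 'I_n | embedb z.1 z.2].
have -> : [set w | embeddable (X w) (Y w)] = \bigcup_(z in [set` s]) F z.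
  apply/seteqP; split=> [w /embeddableP Ew|w [z]].
    by exists (X w, Y w); rewrite //= mem_enum.
  by rewrite /= mem_enum inE => Ez [/= Xw Yw]; apply/embeddableP; rewrite Xw Yw.
have mF z : measurable (F z).
  by apply: measurableI; rewrite -[_ @^-1` _]setTI; exact: measurable_funPT.
have tF : trivIset [set` s] F.
  apply/trivIsetP => z z' _ _ zz'; apply/seteqP; split=> // w [[/= Xz Yz] [/= Xz' Yz']].
  by case/eqP: zz'; apply: injective_projections; rewrite -?Xz -?Yz.
rewrite measure_fin_bigcup //.
rewrite -fsbig_seq ?enum_uniq // big_enum /=.
under eq_bigr => z _ do
  rewrite /F indXY // lX lY -EFinM.
rewrite sumEFin; congr (_%:E).
rewrite /embed_prob pair_big /= big_mkcond /=; apply: eq_bigr => z _.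
by rewrite inE; case: ifP; rewrite ?mulr1 ?mulr0.
Qed.
End EmbeddingEvent.

(** * Elementary limits *)

Section Asymptotics.
Local Open Scope classical_set_scope.
Variable R : realType.

Lemma bernoulli_ineq (c : R) k : -1 <= c -> 1 + k%:R * c <= (1 + c) ^+ k.
Proof.
move=> c1; elim: k => [|k IH]; first by rewrite mul0r addr0 expr0.
have c0 : 0 <= 1 + c by lra.
rewrite exprSr -natr1; apply: le_trans _ (ler_wpM2r c0 IH).
have : 0 <= k%:R * (c * c) by rewrite mulr_ge0 // -expr2 sqr_ge0.
lra.
Qed.

(** Bernoulli's inequality for [u^-1] gives [m * (u^-1 - 1) <= u^-1 ^ m]; multiply by
    [u ^ m * u]. *)
Lemma mulrn_expr_le (u : R) m : 0 < u < 1 -> m%:R * u ^+ m <= u / (1 - u).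
Proof.
move=> /andP[u0 u1].
have c0 : 0 < u^-1 - 1 by rewrite subr_gt0 invf_gt1.
have := @bernoulli_ineq (u^-1 - 1) m; rewrite addrCA subrr addr0 => /(_ _) H.
have {}H : m%:R * (u^-1 - 1) <= u^-1 ^+ m by apply: le_trans _ (H _); lra.
have um : 0 < u ^+ m by exact: exprn_gt0.
rewrite ler_pdivlMr ?subr_gt0 //.
rewrite exprVn in H.
have -> : m%:R * u ^+ m * (1 - u) = (m%:R * (u^-1 - 1)) * (u ^+ m * u).
  by field; rewrite gt_eqF.
apply: (@le_trans _ _ ((u ^+ m)^-1 * (u ^+ m * u))).
  by apply: ler_wpM2r; first by rewrite mulr_ge0 ?ltW.
by rewrite mulKf ?gt_eqF.
Qed.

Lemma cvg_cube_expr_half (t : R) : 0 < t < 1 ->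
  (m%:R ^+ 3 * t ^+ m./2 : R) @[m --> \oo] --> (0 : R).
Proof.
move=> /andP[t0 t1].
(* With [u] the eighth root of [t], [t ^ m./2] is at most [u ^ (4 * m) / u ^ 4], where [u ^ 4]
   covers odd [m]. Three of the four factors [u ^ m] absorb [m ^ 3], and the last one tends to 0. *)
pose u := Num.sqrt (Num.sqrt (Num.sqrt t)).
have u8 : u ^+ 8 = t.
  rewrite /u (exprM _ 2 4) sqr_sqrtr ?sqrtr_ge0 //.
  by rewrite (exprM _ 2 2) sqr_sqrtr ?sqrtr_ge0 // sqr_sqrtr ?ltW.
have u0 : 0 < u by rewrite !sqrtr_gt0.
have u1 : u < 1.
  by rewrite ltNge; apply/negP => u1; have := exprn_ege1 8 u1; rewrite u8 leNgt t1.
pose K := (u / (1 - u)) ^+ 3 / u ^+ 4.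
apply: (@squeeze_cvgr _ _ _ _ (fun=> 0) (fun m => K * u ^+ m)); last 2 first.
- exact: cvg_cst.
- rewrite -[X in _ --> X](mulr0 K); apply: cvgM; first exact: cvg_cst.
  by apply: cvg_expr; rewrite ger0_norm // ltW.
near=> m.
apply/andP; split; first by rewrite mulr_ge0 ?exprn_ge0 // ltW.
have step : t ^+ m./2 * u ^+ 4 <= (u ^+ m) ^+ 3 * u ^+ m.
  rewrite -u8 -!exprM -!exprD; apply: ler_wiXn2l; rewrite ?ltW //.
  have := odd_double_half m; have : (odd m <= 1)%N by case: (odd m).
  by rewrite -mul2n; lia.
have u40 : 0 < u ^+ 4 by exact: exprn_gt0.
rewrite -(ler_pM2r u40) -mulrA /K [X in _ <= X]mulrAC divfK ?gt_eqF //.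
apply: (@le_trans _ _ (m%:R ^+ 3 * ((u ^+ m) ^+ 3 * u ^+ m))).
  by apply: ler_wpM2l => //; exact: exprn_ge0.
rewrite mulrA -exprMn; apply: ler_wpM2r; first by rewrite exprn_ge0 // ltW.
apply: lerXn2r; last by apply: mulrn_expr_le; rewrite u0.
- by rewrite nnegrE mulr_ge0 // exprn_ge0 // ltW.
- by rewrite nnegrE divr_ge0 ?subr_ge0 // ltW.
Unshelve. all: by end_near.
Qed.

Lemma near_ln_ge (A : R) : \forall n \near \oo, A <= ln n%:R.
Proof.
have := @cvgr_idn R => /cvgryPge /(_ (expR A)).
apply: filterS => n An; rewrite -[A]expRK ler_ln ?posrE ?expR_gt0 //.
exact: lt_le_trans (expR_gt0 _) An.
Qed.
End Asymptotics.

(** * The size of [eps ^ m] at the two thresholds *)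

Section Threshold.
Local Open Scope classical_set_scope.
Variable R : realType.

Let sqrt2 : R := expR (ln 2 / 2).

Lemma sqrt2_gt1 : 1 < sqrt2.
Proof. by rewrite /sqrt2 expR_gt1 divr_gt0 ?ln_gt0 ?ltr1n. Qed.

Lemma sqr_sqrt2 : sqrt2 ^+ 2 = 2.
Proof.
by rewrite /sqrt2 -expRM_natl mulrC divfK ?pnatr_eq0 // lnK // posrE.
Qed.

Lemma ln2_gt0 : 0 < ln 2 :> R.
Proof. by rewrite ln_gt0 ?ltr1n. Qed.

Lemma ln2_le1 : ln 2 <= 1 :> R.
Proof. by have := @le_ln1Dx R 1; apply; lra. Qed.

Lemma sqrt2_ratio (m n : nat) : (0 < m)%N -> (0 < n)%N ->
  sqrt2 ^+ m.-1 / n%:R = expR ((m%:R - 1) * (ln 2 / 2) - ln n%:R).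
Proof.
move=> m0 n0; rewrite expRD expRN lnK ?posrE ?ltr0n //; congr (_ / _).
by rewrite /sqrt2 -expRM_natl -subn1 natrB.
Qed.

(** Write [L = ln n] and [l = ln 2]. The upper bound on the floor makes the logarithm of [eps] at
    most [- C n * (l / 2) / L]; raising to the power [m n >= L] cancels the division by [L]. *)
Lemma near_floor_threshold (C : nat -> R) (m : nat -> nat) :
  C n @[n --> \oo] --> +oo ->
  C n / ln n%:R @[n --> \oo] --> (0 : R) ->
  (\forall n \near \oo,
      (m n)%:Z = Num.floor (2 * log2 n%:R + 1 - C n / ln n%:R)) ->
  \forall n \near \oo, [/\ ln n%:R <= (m n)%:R :> R,
    sqrt2 ^+ (m n).-1 / n%:R <= 1 &
    (sqrt2 ^+ (m n).-1 / n%:R) ^+ m n <= expR (- (C n * (ln 2 / 2)))].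
Proof.
move=> C_oo C0 mE; near=> n.
have n0 : (0 < n)%N by near: n; exact: nbhs_infty_gt.
have L1 : 1 <= ln n%:R :> R by near: n; exact: near_ln_ge.
have Cn0 : 0 <= C n by near: n; move/cvgryPge : C_oo; exact.
have c12 : C n / ln n%:R <= 1 / 2.
  by near: n; apply: cvgr_le C0 _ _; rewrite divr_gt0.
have mnE : (m n)%:Z = Num.floor (2 * log2 n%:R + 1 - C n / ln n%:R) by near: n.
have [l0 l1] := (ln2_gt0, ln2_le1).
set L := ln n%:R in L1 c12 mnE *; set l : R := ln 2 in l0 l1 *.
set z := 2 * log2 n%:R + 1 - C n / L in mnE.
have L0 : 0 < L by lra.
have mz : (m n)%:R <= z by have := floor_le z; rewrite -mnE.
have zm : z < (m n)%:R + 1.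
  by have := floorD1_gt z; rewrite -mnE intrD.
have LlE : log2 n%:R = L / l by [].
have Ll : L <= L / l by rewrite ler_pdivlMr // ler_piMr // ltW.
(* [m n > 2 * (L / l) - C n / L >= 2 * L - 1 / 2 >= L], as [L >= 1]. *)
have Lm : L <= (m n)%:R by move: zm; rewrite /z LlE; lra.
have m0 : (0 < m n)%N by rewrite -(ltr_nat R); lra.
have expo : ((m n)%:R - 1) * (l / 2) - L <= - (C n * (l / 2) / L).
  have : (m n)%:R - 1 <= 2 * (L / l) - C n / L by move: mz; rewrite /z LlE; lra.
  have l20 : 0 <= l / 2 by rewrite divr_ge0 // ltW.
  move=> /(ler_wpM2r l20).
  have -> : (2 * (L / l) - C n / L) * (l / 2) = L - C n * (l / 2) / L.
    by field; rewrite !gt_eqF.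
  lra.
have Cl0 : 0 <= C n * (l / 2) / L by rewrite !mulr_ge0 ?invr_ge0 // ltW.
rewrite sqrt2_ratio //; split => //.
  by rewrite -[X in _ <= X]expR0 ler_expR; apply: le_trans expo _; rewrite oppr_le0.
rewrite -expRM_natl ler_expR.
apply: (@le_trans _ _ ((m n)%:R * (- (C n * (l / 2) / L)))).
  by apply: ler_wpM2l.
rewrite mulrN lerN2.
have -> : C n * (l / 2) = L * (C n * (l / 2) / L) by field; rewrite gt_eqF.
rewrite [in X in _ <= X](_ : L * _ / L = C n * (l / 2) / L); last by field; rewrite gt_eqF.
exact: ler_wpM2r.
Unshelve. all: by end_near.
Qed.

(** The mirror estimate: the ceiling makes the logarithm of [eps] at least [C n * (l / 2) / L], so
    the powers of the inverse ratio decay. *)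
Lemma near_ceil_threshold (C : nat -> R) (m : nat -> nat) :
  C n @[n --> \oo] --> +oo ->
  (\forall n \near \oo,
      (m n)%:Z = Num.ceil (2 * log2 n%:R + 1 + C n / ln n%:R)) ->
  \forall n \near \oo, (0 < m n)%N /\
    (n%:R / sqrt2 ^+ (m n).-1) ^+ m n <= expR (- (C n * (ln 2 / 2))).
Proof.
move=> C_oo mE; near=> n.
have n0 : (0 < n)%N by near: n; exact: nbhs_infty_gt.
have L1 : 1 <= ln n%:R :> R by near: n; exact: near_ln_ge.
have Cn0 : 0 <= C n by near: n; move/cvgryPge : C_oo; exact.
have mnE : (m n)%:Z = Num.ceil (2 * log2 n%:R + 1 + C n / ln n%:R) by near: n.
have [l0 l1] := (ln2_gt0, ln2_le1).
set L := ln n%:R in L1 mnE *; set l : R := ln 2 in l0 l1 *.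
set z := 2 * log2 n%:R + 1 + C n / L in mnE.
have L0 : 0 < L by lra.
have zm : z <= (m n)%:R by have := ceil_ge z; rewrite -mnE.
have LlE : log2 n%:R = L / l by [].
have Ll : L <= L / l by rewrite ler_pdivlMr // ler_piMr // ltW.
have CL0 : 0 <= C n / L by rewrite divr_ge0 // ltW.
have Lm : L <= (m n)%:R by move: zm; rewrite /z LlE; lra.
have m0 : (0 < m n)%N by rewrite -(ltr_nat R); lra.
split=> //.
have expo : C n * (l / 2) / L <= ((m n)%:R - 1) * (l / 2) - L.
  have : 2 * (L / l) + C n / L <= (m n)%:R - 1 by move: zm; rewrite /z LlE; lra.
  have l20 : 0 <= l / 2 by rewrite divr_ge0 // ltW.
  move=> /(ler_wpM2r l20).
  have -> : (2 * (L / l) + C n / L) * (l / 2) = L + C n * (l / 2) / L.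
    by field; rewrite !gt_eqF.
  lra.
have Cl0 : 0 <= C n * (l / 2) / L by rewrite !mulr_ge0 ?invr_ge0 // ltW.
rewrite -[n%:R / _]invf_div sqrt2_ratio // -expRN -expRM_natl ler_expR.
rewrite mulrN lerN2.
have -> : C n * (l / 2) = L * (C n * (l / 2) / L) by field; rewrite gt_eqF.
by apply: ler_pM => //; exact: ltW.
Unshelve. all: by end_near.
Qed.
End Threshold.

(** * Limits of the embedding probability *)

Section Limits.
Local Open Scope classical_set_scope.
Variables (R : realType) (p : R) (C : nat -> R) (m : nat -> nat).
Hypotheses (p01 : 0 < p < 1) (C_oo : C n @[n --> \oo] --> +oo).

Let sqrt2 : R := expR (ln 2 / 2).

Lemma cvg_expR_threshold : expR (- (C n * (ln 2 / 2))) @[n --> \oo] --> (0 : R).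
Proof.
have c0 : 0 < ln 2 / 2 :> R by rewrite divr_gt0 // ln2_gt0.
apply: (@cvg_comp _ _ _ (fun n => C n * (ln 2 / 2)) (fun x => expR (- x))); last exact: cvgr_expR.
apply/cvgryPge => A; move/cvgryPge : C_oo => /(_ (A / (ln 2 / 2))).
by apply: filterS => n; rewrite ler_pdivrMr.
Qed.

Lemma embed_prob_cvg1 :
  C n / ln n%:R @[n --> \oo] --> (0 : R) ->
  (\forall n \near \oo,
      (m n)%:Z = Num.floor (2 * log2 n%:R + 1 - C n / ln n%:R)) ->
  embed_prob p (m n) n @[n --> \oo] --> (1 : R).
Proof.
move=> C0 mE; have /andP[p0 p1] := p01.
have p01' : 0 <= p <= 1 by rewrite !ltW.
have near_m := near_floor_threshold C_oo C0 mE.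
have m_oo : m n @[n --> \oo] --> \oo.
  apply/cvgnyPge => A; near=> n.
  have [Lm _ _] : [/\ ln n%:R <= (m n)%:R :> R, sqrt2 ^+ (m n).-1 / n%:R <= 1 &
    (sqrt2 ^+ (m n).-1 / n%:R) ^+ m n <= expR (- (C n * (ln 2 / 2)))] by near: n.
  by rewrite -(ler_nat R); apply: le_trans _ Lm; near: n; exact: near_ln_ge.
set q := p ^+ 2 + (1 - p) ^+ 2.
(* [q = 1 - 2 * p * (1 - p)] is the probability that two independent edges agree; [0 < p < 1] enters
   here. *)
have q1 : q < 1.
  have : 0 < p * (1 - p) by rewrite mulr_gt0 // subr_gt0.
  by rewrite /q; lra.
have q0 : 0 <= q by rewrite addr_ge0 // sqr_ge0.
(* Chosen so that Bernoulli's inequality gives [r ^ 14 >= 1 - (1 - q) = q]. *)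
pose r := 1 - (1 - q) / 14.
have r01 : 0 < r < 1 by rewrite /r; apply/andP; split; lra.
have qr : q <= r ^+ 14.
  by apply: le_trans _ (bernoulli_ineq 14 _); lra.
have sV : 0 < sqrt2^-1 < 1.
  by have s1 := sqrt2_gt1 R; rewrite invr_gt0 invf_lt1 ?s1 ?(lt_trans ltr01 s1).
pose a k : R := k%:R ^+ 3 * sqrt2^-1 ^+ k./2.
pose b k : R := k%:R ^+ 3 * r ^+ k./2.
have a_cvg : a (m n) @[n --> \oo] --> (0 : R).
  exact: (@cvg_comp _ _ _ m a _ _ _ m_oo (cvg_cube_expr_half sV)).
have b_cvg : b (m n) @[n --> \oo] --> (0 : R).
  exact: (@cvg_comp _ _ _ m b _ _ _ m_oo (cvg_cube_expr_half r01)).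
(* The second moment bound with [eps ^ m] replaced by its exponential majorant; it tends to
   [2 - 1 = 1]. *)
pose low n : R := 2 - (1 + 4 * a (m n) + 2 * expR (- (C n * (ln 2 / 2)))) / (1 - a (m n)).
apply: (@squeeze_cvgr _ _ _ _ low (fun=> 1)); last 2 first.
- have limE : 2 - (1 + 4 * 0 + 2 * 0) / (1 - 0) = 1 :> R.
    by rewrite !mulr0 !addr0 subr0 divr1; lra.
  rewrite -[X in _ --> X]limE.
  apply: cvgB; first exact: cvg_cst.
  apply: cvgM; last first.
    apply: cvgV; first by rewrite subr0 oner_neq0.
    by apply: cvgB; [exact: cvg_cst|exact: a_cvg].
  apply: cvgD; last by apply: cvgM; [exact: cvg_cst|exact: cvg_expR_threshold].
  apply: cvgD; first exact: cvg_cst.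
  by apply: cvgM; [exact: cvg_cst|exact: a_cvg].
- exact: cvg_cst.
near=> n.
apply/andP; split; last exact: embed_prob_le1.
have n0 : (0 < n)%N by near: n; exact: nbhs_infty_gt.
have [_ eps1 epsm] : [/\ ln n%:R <= (m n)%:R :> R, sqrt2 ^+ (m n).-1 / n%:R <= 1 &
    (sqrt2 ^+ (m n).-1 / n%:R) ^+ m n <= expR (- (C n * (ln 2 / 2)))] by near: n.
have m8 : (8 <= m n)%N by near: n; move/cvgnyPge : m_oo; exact.
have a1 : 2 * a (m n) <= 1.
  have : a (m n) <= 1 / 2 by near: n; apply: cvgr_le a_cvg _ _; rewrite divr_gt0.
  lra.
have b1 : 2 * b (m n) <= 1.
  have : b (m n) <= 1 / 2 by near: n; apply: cvgr_le b_cvg _ _; rewrite divr_gt0.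
  lra.
have s1 : 1 <= sqrt2 by rewrite ltW // sqrt2_gt1.
have r01' : 0 <= r <= 1 by case/andP: r01 => *; rewrite !ltW.
have mn := m_le_n s1 m8 n0 a1 eps1.
apply: le_trans _ (embed_prob_ge p01' r01' qr m8 mn).
rewrite /low lerD2l lerN2.
apply: le_trans (overlap_ratio_le r01' s1 (sqr_sqrt2 R) m8 n0 a1 b1 eps1) _.
apply: ler_wpM2r; first by rewrite invr_ge0 -/(a (m n)); move: a1; generalize (a (m n)) => c; lra.
by rewrite lerD2l ler_pM2l.
Unshelve. all: by end_near.
Qed.

Lemma embed_prob_cvg0 :
  (\forall n \near \oo,
      (m n)%:Z = Num.ceil (2 * log2 n%:R + 1 + C n / ln n%:R)) ->
  embed_prob p (m n) n @[n --> \oo] --> (0 : R).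
Proof.
move=> mE; have /andP[p0 p1] := p01.
have p01' : 0 <= p <= 1 by rewrite !ltW.
apply: (@squeeze_cvgr _ _ _ _ (fun=> 0) (fun n => expR (- (C n * (ln 2 / 2))))); last 2 first.
- exact: cvg_cst.
- exact: cvg_expR_threshold.
near=> n.
rewrite embed_prob_ge0 //=.
have [m0 ratio] : (0 < m n)%N /\
    (n%:R / sqrt2 ^+ (m n).-1) ^+ m n <= expR (- (C n * (ln 2 / 2))).
  by near: n; exact: near_ceil_threshold C_oo mE.
apply: le_trans (embed_prob_le _ _ p01') _; apply: le_trans _ ratio.
have s1 := sqrt2_gt1 R.
(* The mean is at most [n ^ m / 2 ^ C(m, 2) = (n / s ^ (m - 1)) ^ m], where [s] is the square root
   of 2. *)
rewrite /mean_emb !expr_div_n -(expr2_bin _ (sqr_sqrt2 R)) expr1n mul1r.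
by apply: ler_wpM2r; rewrite ?invr_ge0 ?exprn_ge0 // -natrX ler_nat ffact_le_expn.
Unshelve. all: by end_near.
Qed.
End Limits.

(** * Transfer of the limits to the random graphs *)

Local Open Scope classical_set_scope.

Theorem theorem2p3 (R : realType) (p : R) (C : nat -> R)
    (d : nat -> nat -> measure_display)
    (T : forall m n : nat, measurableType (d m n))
    (P : forall m n : nat, probability (T m n) R)
    (X : forall m n : nat, {RV (P m n) >-> sgraph 'I_m})
    (Y : forall m n : nat, {RV (P m n) >-> sgraph 'I_n}) :
  0 < p < 1 ->
  C n @[n --> \oo] --> +oo ->
  C n / ln n%:R @[n --> \oo] --> (0 : R) ->
  (forall m n : nat, (0 < m)%N -> (0 < n)%N ->
    [/\ has_law_Gnp (X m n) p,
        has_law_Gnp (Y m n) (1 / 2) &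
        independent_RV (X m n) (Y m n)]) ->
  (forall m : nat -> nat,
    (\forall n \near \oo,
      (m n)%:Z = Num.floor (2 * log2 n%:R + 1 - C n / ln n%:R)) ->
    P (m n) n [set w | embeddable (X (m n) n w) (Y (m n) n w)]
      @[n --> \oo] --> 1%E) /\
  (forall m : nat -> nat,
    (\forall n \near \oo,
      (m n)%:Z = Num.ceil (2 * log2 n%:R + 1 + C n / ln n%:R)) ->
    P (m n) n [set w | embeddable (X (m n) n w) (Y (m n) n w)]
      @[n --> \oo] --> 0%E).
Proof.
move=> p01 C_oo C0 law.
(* The laws are prescribed at positive sizes, so the probability equals [embed_prob] as soon as
   [m n] and [n] are positive. *)
have transfer_limit (m : nat -> nat) (l : R) : (\forall n \near \oo, (0 < m n)%N) ->
    embed_prob p (m n) n @[n --> \oo] --> l ->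
    P (m n) n [set w | embeddable (X (m n) n w) (Y (m n) n w)] @[n --> \oo] --> l%:E.
  move=> m0 lim.
  have lim' : (embed_prob p (m n) n)%:E @[n --> \oo] --> l%:E.
    by apply/fine_cvgP; split => //; exact: nearW.
  apply: cvg_trans lim'; apply: near_eq_cvg; near=> n.
  have [lawX lawY ind] : [/\ has_law_Gnp (X (m n) n) p,
      has_law_Gnp (Y (m n) n) (1 / 2) & independent_RV (X (m n) n) (Y (m n) n)].
    by apply: law; near: n; [exact: m0|exact: nbhs_infty_gt].
  exact/esym/embeddable_probability.
split=> m mE; apply: transfer_limit.
- apply: filterS2 (near_floor_threshold C_oo C0 mE) (near_ln_ge 1) => n [Lm _ _] L1.
  by rewrite -(ltr_nat R) (lt_le_trans ltr01) // (le_trans L1).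
- exact: embed_prob_cvg1 C0 mE.
- by apply: filterS (near_ceil_threshold C_oo mE) => n [].
- exact: embed_prob_cvg0 mE.
Unshelve. all: by end_near.
Qed.
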